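(* Let $(T_n)_{n\ge 1}$ be a uniform random recursive tree, and let $H_K$ be the set of the top $K$ most central vertices of $T_n$ according to Jordan centrality. For every $\varepsilon>0$, if $K\ge 66/\varepsilon$, then $$\liminf_{n\to\infty}\mathbb{P}(1\in H_K)\ge 1-\varepsilon.$$
   Context: A uniform random recursive tree (URRT) is a random sequence of trees $(T_n)_{n\ge 1}$ with $V(T_n)=[n]=\{1,\ldots,n\}$: $T_1$ is the single vertex $1$ (the root), and $T_{n+1}$ is obtained from $T_n$ by adding vertex $n+1$ and an edge $\{i,n+1\}$, where $i$ is chosen uniformly at random from $[n]$, independently of the past. For a tree $T$ and vertices $u,v$ of $T$, $(T,v)_{u\downarrow}$ denotes the subtree containing all vertices $w$ such that the path from $w$ to $v$ contains $u$ (rooted at $u$), and $|\cdot|$ denotes its number of vertices. The Jordan centrality of $v\in V(T_n)$ is $\psi_{T_n}(v)=\max_{u\in V(T_n)\setminus\{v\}}|(T_n,v)_{u\downarrow}|$; smaller values correspond to more central vertices. Ranking: vertices are ordered from most to least central; vertices with equal centrality value are ordered in reverse order of insertion time (if $u,v$ have equal centrality, $u$ is ranked before $v$ iff $u>v$). This gives a permutation $\gamma_n$ of $[n]$, where $\gamma_n(v)\in\{1,\ldots,n\}$ is the position of $v$ in this order (position $1$ being most central). For a positive integer $K$, $H_K=H_K(n)=\{v\in V(T_n):\gamma_n(v)\le K\}$. *)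

(* Defs.v *)
From HB Require Import structures.
From mathcomp Require Export all_boot all_order all_algebra finmap.
From mathcomp Require Export all_classical all_reals all_analysis.

Set Implicit Arguments.
Unset Strict Implicit.
Unset Printing Implicit Defensive.

Import Order.TTheory GRing.Theory Num.Theory.

Local Open Scope fset_scope.

(* An edge {u, v} is the finite set [fset u; v]. *)
Record graph := Graph {
  vertices : {fset nat};
  edges : {fset {fset nat}} }.

Definition adjacent (G : graph) : rel nat :=
  fun u v => [fset u; v] \in edges G.

(* The vertex sequence of the path is w :: p. *)
Definition path_from_to (G : graph) (w v : nat) (p : seq nat) : Prop :=
  [/\ path (adjacent G) w p, last w p = v & uniq (w :: p)].

(* The vertex set of (G, v)_{u downarrow}. In a tree the path from w to v
   exists and is unique, so "the path from w to v contains u" is rendered as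
   "some path from w to v contains u". *)
Definition subtree (G : graph) (v u : nat) : {fset nat} :=
  [fset w in vertices G |
    `[< exists p, path_from_to G w v p /\ u \in w :: p >]].

Definition jordan (G : graph) (v : nat) : nat :=
  \max_(u <- enum_fset (vertices G `\ v)) #|` subtree G v u|.

(* Reflexive order: u is v, or u is ranked before v. *)
Definition ranked_le (G : graph) : rel nat := fun u v =>
  (jordan G u < jordan G v)%N ||
  ((jordan G u == jordan G v) && (v <= u)%N).

Definition ranking (G : graph) : seq nat :=
  sort (ranked_le G) (enum_fset (vertices G)).

(* [index] counts from 0, positions count from 1. *)
Definition position (G : graph) (v : nat) : nat := (index v (ranking G)).+1.

Definition top_central (K : nat) (G : graph) : {fset nat} :=
  [fset v in vertices G | (position G v <= K)%N].

Definition single_vertex : graph := Graph [fset 1%N] fset0.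

Definition attach (G : graph) (i v : nat) : graph :=
  Graph (v |` vertices G) ([fset i; v] |` edges G).

Local Open Scope classical_set_scope.
Local Open Scope ereal_scope.

(* The sequences T and I are indexed from 1 (their values at 0 are
   irrelevant); I n is the neighbour chosen for vertex n+1. Each T k takes
   finitely many values, so independence of I n from the past (T 1, ..., T n)
   is the product rule on the atoms {I n = i} and {T 1 = t 1, ..., T n = t n}. *)
Definition is_URRT d (Omega : measurableType d) (R : realType)
    (P : probability Omega R) (T : nat -> Omega -> graph) : Prop :=
  (forall w, T 1%N w = single_vertex) /\
  exists I : nat -> {RV P >-> nat}, forall n, (0 < n)%N ->
    [/\ forall w, (1 <= I n w <= n)%N,
        forall i, (1 <= i <= n)%N -> P [set w | I n w = i] = (n%:R^-1)%:E,
        forall (i : nat) (t : nat -> graph),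
          P ([set w | I n w = i] `&`
             [set w | forall k, (1 <= k <= n)%N -> T k w = t k]) =
          P [set w | I n w = i] *
          P [set w | forall k, (1 <= k <= n)%N -> T k w = t k]
      & forall w, T n.+1 w = attach (T n w) (I n w) n.+1].

(* Main.v *)
Require Import Defs.
From mathcomp Require Import ring lra zify.

Set Implicit Arguments.
Unset Strict Implicit.
Unset Printing Implicit Defensive.

Import Order.TTheory GRing.Theory Num.Theory.

Local Open Scope ring_scope.

(** Root the tree at 1 and let D_v be the set of descendants of v. If 1 is not
    among the K most central vertices, then for the child c of 1 with the
    largest D_c at least K vertices v of D_c satisfy
    |D_v| >= n - |D_c|. When v is inserted, |D_v| = 1 against
    b = n - |D_c| vertices outside D_c; these two counts evolve as a Polya urn,
    so |D_v| catches up with probability of order 2^-b. In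
    mean there are 1/k children of 1 with exactly k descendants, so at the time
    when the tree has a + 1 vertices, b = 1 has probability 1/a. Otherwise
    b >= 2 for every child from then on, and an explicit supermartingale bounds
    the expected number of later vertices that catch up by a constant. Hence
    the failure probability is at most 1/a + 6/(K - a), and a = K/2 gives less
    than 66/K. *)

(** * Recursive trees coded by parent lists *)

(* The head of [s] is the parent of the latest vertex, [size s + 1]; hence
   [recursive_tree s] has vertices [1 .. size s + 1]. *)
Fixpoint recursive_tree (s : seq nat) : graph :=
  if s is i :: s' then attach (recursive_tree s') i (size s').+2
  else single_vertex.

Fixpoint valid (s : seq nat) : bool :=
  if s is i :: s' then (0 < i < (size s').+2)%N && valid s' else true.

(* [desc s u v]: [v] is a descendant of [u], or [u] itself. *)
Fixpoint desc (s : seq nat) (u v : nat) : bool :=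
  if s is i :: s' then
    if v == (size s').+2 then (u == v) || desc s' u i else desc s' u v
  else (u == 1%N) && (v == 1%N).

Fixpoint child (s : seq nat) (c : nat) : bool :=
  if s is i :: s' then
    if c == (size s').+2 then i == 1%N else child s' c
  else false.

Definition weight (s : seq nat) (u : nat) : nat :=
  \sum_(1 <= v < (size s).+2) desc s u v.

Lemma desc_bounds s u v : valid s -> desc s u v ->
  [&& 0 < u, u <= v & v < (size s).+2]%N.
Proof.
elim: s u v => [|i s IH] u v /=; first by move=> _ /andP[/eqP -> /eqP ->].
case/andP=> hi hs; case: ifP => [/eqP -> /orP[/eqP -> | /(IH _ _ hs)]|_ /(IH _ _ hs)]; lia.
Qed.

Lemma desc_refl s v : valid s -> (0 < v < (size s).+2)%N -> desc s v v.
Proof.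
elim: s v => [|i s IH] v /=; first by move=> _ ?; have -> : v = 1%N by lia.
case/andP=> hi hs hv; case: ifP => [_|/eqP h]; first by rewrite eqxx.
by apply: IH => //; lia.
Qed.

Lemma desc_trans s u v x : valid s -> desc s u v -> desc s v x -> desc s u x.
Proof.
elim: s u v x => [|i s IH] u v x; first by move=> _ /andP[/eqP -> _] /andP[].
move=> hv; have := hv => /= /andP[hi hs].
case: (eqVneq x) => [-> |_].
  move=> h /orP[/eqP hvx | hvi]; first by move: h; rewrite hvx eqxx.
  rewrite (IH u v i) ?orbT //.
  by move: h hvi; case: (eqVneq v) => // -> _ /(desc_bounds hs); lia.
move=> h1 h2; apply: (IH u v) => //.
by move: h1 h2; case: (eqVneq v) => // -> _ /(desc_bounds hs); lia.
Qed.

Lemma desc_chain s u v x : valid s -> desc s u x -> desc s v x ->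
  desc s u v || desc s v u.
Proof.
elim: s u v x => [|i s IH] u v x; first by move=> _ /andP[/eqP -> _] /andP[/eqP -> _].
move=> hv; have := hv => /= /andP[hi hs].
have old y z t : desc s y t -> desc s z t ->
    (if z == (size s).+2 then (y == z) || desc s y i else desc s y z)
 || (if y == (size s).+2 then (z == y) || desc s z i else desc s z y).
  move=> h1 h2; have := desc_bounds hs h1; have := desc_bounds hs h2 => b1 b2.
  have -> : (z == (size s).+2) = false by lia.
  have -> : (y == (size s).+2) = false by lia.
  exact: IH h2.
case: (eqVneq x) => [-> |_]; last exact: old.
case/orP=> [/eqP -> | h1] /orP[/eqP -> | h2].
- by rewrite eqxx.
- by rewrite eqxx h2 !orbT.
- by rewrite eqxx h1 orbT.
- exact: old h1 h2.
Qed.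

Lemma child_bounds s c : child s c -> (1 < c < (size s).+2)%N.
Proof.
elim: s => [|i s IH] //=; case: ifP => [/eqP -> |_ /IH]; lia.
Qed.

Lemma desc_child_exists s u : valid s -> (1 < u < (size s).+2)%N ->
  exists2 c, child s c & desc s c u.
Proof.
elim: s u => [|i s IH] u; first by move=> _ /=; lia.
move=> hv; have := hv => /= /andP[hi hs] hu.
have old y : (1 < y < (size s).+2)%N -> exists2 c, c != (size s).+2 & child s c && desc s c y.
  move=> hy; have [c h1 h2] := IH y hs hy.
  by exists c; rewrite ?h1 //; have := child_bounds h1; lia.
case: (eqVneq u) hu => [-> _|hne hu].
  case: (eqVneq i 1%N) => [-> | hi1]; first by exists (size s).+2; rewrite ?eqxx.
  have [|c hc /andP[h1 h2]] := old i; first by lia.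
  by exists c; rewrite ?(negbTE hc) // h2 orbT.
have [|c hc /andP[h1 h2]] := old u; first by lia.
by exists c; rewrite ?(negbTE hc).
Qed.

Lemma child_desc_root s c : valid s -> child s c -> desc s c 1 = false.
Proof.
by move=> hs /child_bounds hc; apply/negP => /(desc_bounds hs); lia.
Qed.

Lemma parent_of_child s u c : valid s -> child s c -> desc s u c -> u = c \/ u = 1%N.
Proof.
elim: s => [|i s IH] //= /andP[hi hs].
case: (eqVneq c) => [-> /eqP -> /orP[/eqP -> | h]|_]; [by left| |exact: IH].
by right; have := desc_bounds hs h; lia.
Qed.

(** With a common descendant, [v] and [c] would be comparable; an ancestor of the child [c] is [c]
    or 1, and both are excluded. Strictness comes from the root, which lies below neither. *)
Lemma disjoint_weights s c v : valid s -> child s c -> (1 < v)%N ->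
  ~~ desc s c v -> (weight s v + weight s c < (size s).+1)%N.
Proof.
move=> hs hc hv hcv; rewrite /weight -big_split /=.
rewrite big_ltn // (child_desc_root hs hc).
have -> : desc s v 1 = false by apply/negP => /(desc_bounds hs); lia.
rewrite !add0n ltnS (@leq_trans (\sum_(2 <= x < (size s).+2) 1)) //; last first.
  by rewrite sum_nat_const_nat; lia.
apply: leq_sum => x _.
case h1: (desc s v x); case h2: (desc s c x) => //.
have := desc_chain hs h1 h2; rewrite (negbTE hcv) orbF => /(parent_of_child hs hc).
case=> h; last lia.
by move: hcv; rewrite -h desc_refl //; have := desc_bounds hs h1; lia.
Qed.

Lemma desc_new s v : valid s -> desc s (size s).+2 v = false.
Proof. by move=> hs; apply/negP => /(desc_bounds hs); lia. Qed.

Section Extend.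
Variables (s : seq nat) (i : nat).
Hypotheses (hs : valid s) (hi : (0 < i < (size s).+2)%N).

Lemma weight_old u : (u < (size s).+2)%N ->
  weight (i :: s) u = (weight s u + desc s u i)%N.
Proof.
move=> hu; rewrite /weight big_nat_recr //= eqxx.
have -> : (u == (size s).+2) = false by lia.
congr addn; rewrite big_nat_cond [RHS]big_nat_cond; apply: eq_bigr => v hv.
by have -> : (v == (size s).+2) = false by lia.
Qed.

Lemma weight_new : weight (i :: s) (size s).+2 = 1%N.
Proof.
rewrite /weight big_nat_recr //= !eqxx big_nat_cond big1 // => v hv.
by rewrite ifF ?desc_new //; lia.
Qed.

End Extend.

(** * Jordan centrality of a recursive tree *)

Lemma vertices_recursive_tree s x :
  (x \in vertices (recursive_tree s)) = (0 < x < (size s).+2)%N.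
Proof.
elim: s => [|i s IH] /=; first by rewrite inE; lia.
by rewrite in_fset1U IH; lia.
Qed.

Lemma fset2_eqE (a b c e : nat) :
  ([fset a; b] == [fset c; e])%fset =
  ((a == c) && (b == e)) || ((a == e) && (b == c)).
Proof.
apply/eqP/idP => [h|/orP[] /andP[/eqP -> /eqP ->] //]; last by rewrite fsetUC.
have ha : (a \in [fset c; e])%fset by rewrite -h in_fset2 eqxx.
have hb : (b \in [fset c; e])%fset by rewrite -h in_fset2 eqxx orbT.
have hc : (c \in [fset a; b])%fset by rewrite h in_fset2 eqxx.
have he : (e \in [fset a; b])%fset by rewrite h in_fset2 eqxx orbT.
by move: ha hb hc he; rewrite !in_fset2; lia.
Qed.

Lemma adjacent_recursive_tree i s x y :
  adjacent (recursive_tree (i :: s)) x y =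
  [|| (x == i) && (y == (size s).+2), (x == (size s).+2) && (y == i)
    | adjacent (recursive_tree s) x y].
Proof. by rewrite /adjacent /= in_fset1U fset2_eqE -orbA. Qed.

Lemma adjacent_nil x y : adjacent (recursive_tree [::]) x y = false.
Proof. by []. Qed.

Lemma adjacent_sym G : symmetric (adjacent G).
Proof. by move=> x y; rewrite /adjacent fsetUC. Qed.

Lemma adjacent_bounds s x y : valid s -> adjacent (recursive_tree s) x y ->
  [&& 0 < x, x < (size s).+2, 0 < y & y < (size s).+2]%N.
Proof.
elim: s => [|i s IH]; first by rewrite adjacent_nil.
rewrite adjacent_recursive_tree /= => /andP[hi hs].
by case/or3P=> [/andP[/eqP -> /eqP ->]|/andP[/eqP -> /eqP ->]|/(IH hs)]; lia.
Qed.

(** The only edge between the descendants of [c] and the rest of the tree joins [c] to the root. *)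
Lemma adjacent_child s c x y : valid s -> child s c ->
  adjacent (recursive_tree s) x y -> x != 1%N -> y != 1%N ->
  desc s c x = desc s c y.
Proof.
elim: s x y => [|i s IH] x y; first by rewrite adjacent_nil.
have desc_edge j : (0 < j < (size s).+2)%N -> valid s -> j != 1%N ->
    child (j :: s) c -> desc (j :: s) c j = desc (j :: s) c (size s).+2.
  move=> hj hs hj1 hc /=; rewrite eqxx ifF; last by lia.
  by move: hc => /=; case: (eqVneq c) => // _ /eqP h; rewrite h eqxx in hj1.
move=> hv hc; have := hv => /= /andP[hi hs].
rewrite adjacent_recursive_tree => /or3P[/andP[/eqP -> /eqP ->] h1 h2| /andP[/eqP -> /eqP ->] h1 h2|].
- exact: desc_edge.
- by symmetry; apply: desc_edge.
move=> hxy h1 h2; have := adjacent_bounds hs hxy => hb.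
rewrite /= !ifF; try lia.
case: (eqVneq c (size s).+2) => [->|hne]; first by rewrite !desc_new.
by apply: IH => //; move: hc => /=; rewrite (negbTE hne).
Qed.

Lemma parent_exists s v : valid s -> (1 < v < (size s).+2)%N ->
  exists2 u, adjacent (recursive_tree s) u v & (u < v)%N && desc s u v.
Proof.
elim: s v => [|i s IH] v; first by move=> _ /=; lia.
move=> hv; have := hv => /= /andP[hi hs] hb.
case: (eqVneq v (size s).+2) => [->|hne].
  exists i; first by rewrite adjacent_recursive_tree !eqxx.
  by rewrite desc_refl // orbT; lia.
have [|u h1 /andP[h2 h3]] := IH v hs; first by lia.
by exists u; rewrite ?adjacent_recursive_tree ?h1 ?orbT // h2.
Qed.

(** A simple path ending at 1 can cross the edge from [c] to 1 only in its last step, so if it meets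
    the descendants of [c], it started among them. *)
Lemma path_to_root_desc_child s c u x p : valid s -> child s c ->
  path (adjacent (recursive_tree s)) x p -> last x p = 1%N -> uniq (x :: p) ->
  u \in x :: p -> u != 1%N -> desc s c u -> desc s c x.
Proof.
move=> hs hc; elim: p x => [|y p IH] x.
  by move=> _ /= -> _; rewrite inE => ->.
rewrite /= => /andP[hxy hp] hl /andP[hx hu] hin hu1 hcu.
case: (eqVneq u x) => [<- //|hne].
have hcy : desc s c y.
  by apply: IH => //; move: hin; rewrite inE (negbTE hne).
have hx1 : x != 1%N by apply: contraNneq hx => ->; rewrite -hl mem_last.
rewrite (adjacent_child hs hc hxy hx1) //.
by apply: contraTneq hcy => ->; rewrite child_desc_root.
Qed.

Lemma weight_filter s u :
  weight s u = size [seq v <- index_iota 1 (size s).+2 | desc s u v].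
Proof.
by rewrite /weight size_filter -sum1_count [RHS]big_mkcond; apply: eq_bigr => v _; case: desc.
Qed.

Lemma card_le_weight s (A : {fset nat}) c :
  {in A, forall x, (0 < x < (size s).+2)%N && desc s c x} ->
  (#|` A| <= weight s c)%N.
Proof.
move=> hA; rewrite weight_filter; apply: uniq_leq_size; first exact: fset_uniq.
by move=> x /hA; rewrite mem_filter mem_index_iota andbC.
Qed.

Lemma card_ge_weight s (A : {fset nat}) c :
  (forall x, (0 < x < (size s).+2)%N -> ~~ desc s c x -> x \in A) ->
  ((size s).+1 <= #|` A| + weight s c)%N.
Proof.
move=> hA; rewrite weight_filter.
rewrite -[X in (X <= _)%N](size_iota 1 (size s).+1) -[iota 1 _]/(index_iota 1 (size s).+2).
rewrite -(count_predC (desc s c)) !size_filter addnC leq_add2r -size_filter.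
apply: uniq_leq_size; first by rewrite filter_uniq // iota_uniq.
by move=> x; rewrite mem_filter mem_index_iota => /andP[h1 h2]; apply: hA.
Qed.

(** For [u] below the child [c], every vertex whose path to 1 passes through [u] is a descendant of
    [c]. The child is carried as a witness through the maximum. *)
Lemma jordan_root_le s : valid s -> (0 < size s)%N ->
  exists2 c, child s c & (jordan (recursive_tree s) 1 <= weight s c)%N.
Proof.
move=> hs hsz; rewrite /jordan big_seq.
apply: (big_ind (fun k => exists2 c, child s c & (k <= weight s c)%N)).
- by have [//|c hc _] := @desc_child_exists s 2 hs; exists c.
- move=> x y [c hc hxc] [e he hye].
  by case: (leqP x y) => _; [exists e|exists c].
- move=> u; rewrite in_fsetD1 vertices_recursive_tree => /andP[hu1 hu].
  have [|c hc hcu] := @desc_child_exists s u hs; first by lia.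
  exists c => //; apply: card_le_weight => x.
  rewrite !inE /= vertices_recursive_tree => /andP[-> /asboolP[p [[hp hl hun] hin]]] /=.
  exact: (path_to_root_desc_child hs hc hp hl hun hin hu1 hcu).
Qed.

(** Climb from parent to parent: an ancestor of [x] below [v] would put [x] itself below [v]. *)
Lemma path_to_root_avoiding s v x : valid s -> (1 < v)%N ->
  (0 < x < (size s).+2)%N -> ~~ desc s v x ->
  exists2 p, path (fun y z => adjacent (recursive_tree s) y z && ~~ desc s v z) x p
    & last x p = 1%N.
Proof.
move=> hs hv; elim/ltn_ind: x => x IH hx hvx.
case: (eqVneq x 1%N) => [->|hx1]; first by exists [::].
have [|u h1 /andP[h2 h3]] := @parent_exists s x hs; first by lia.
have hvu : ~~ desc s v u by apply: contra hvx => h; apply: desc_trans h h3.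
have [|p hp hl] := IH u h2 _ hvu; first by have := adjacent_bounds hs h1; lia.
by exists (u :: p) => //=; rewrite adjacent_sym h1 hvu.
Qed.

Lemma path_avoiding s v x y : valid s -> (1 < v)%N ->
  (0 < x < (size s).+2)%N -> ~~ desc s v x ->
  (0 < y < (size s).+2)%N -> ~~ desc s v y ->
  exists2 p, path (fun y z => adjacent (recursive_tree s) y z && ~~ desc s v z) x p
    & last x p = y.
Proof.
move=> hs hv hx hvx hy hvy.
have [p hp hpl] := path_to_root_avoiding hs hv hx hvx.
have [q hq hql] := path_to_root_avoiding hs hv hy hvy.
exists (p ++ rev (belast y q)); last first.
  by rewrite last_cat hpl; case: (q) hql => [<- //|z q' _]; rewrite /= rev_cons last_rcons.
rewrite cat_path hp hpl -hql rev_path.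
have : all (fun z => ~~ desc s v z) (y :: q).
  rewrite /= hvy /=; apply/allP => z hz.
  by elim: q (y) hq hz {hql} => // t q IH y' /= /andP[/andP[_ h] /IH{}IH]; rewrite inE => /orP[/eqP ->|].
elim: q (y) hq {hql} => //= t q IH y' /andP[/andP[h1 h2] hq] /andP[h3 h4].
by rewrite adjacent_sym h1 h3 IH.
Qed.

(** Seen from [v], the branch through its parent [u] contains all non-descendants of [v]: each
    reaches [u] while avoiding the descendants of [v], and then steps to [v]. *)
Lemma jordan_ge s v : valid s -> (1 < v < (size s).+2)%N ->
  ((size s).+1 <= jordan (recursive_tree s) v + weight s v)%N.
Proof.
move=> hs hv; have [u huv /andP[hlt hdesc]] := parent_exists hs hv.
have hb := adjacent_bounds hs huv.
have hvu : ~~ desc s v u by apply/negP => /(desc_bounds hs); lia.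
apply: (@leq_trans (#|` subtree (recursive_tree s) v u| + weight s v)); last first.
  rewrite leq_add2r /jordan.
  have hin : (u : nat) \in enum_fset (vertices (recursive_tree s) `\ v)%fset.
    by rewrite in_fsetD1 vertices_recursive_tree; lia.
  exact: (@leq_bigmax_seq nat _ predT (fun u => #|` subtree (recursive_tree s) v u|) u hin isT).
apply: card_ge_weight => x hx hvx.
rewrite !inE /= vertices_recursive_tree hx /=; apply/asboolP.
have [| |p hp hl] := path_avoiding hs _ hx hvx _ hvu (y := u); try lia.
case/shortenP: hp hl => p' hp' hun _ hl.
have hav : all (fun z => ~~ desc s v z) p'.
  apply/allP => z; elim: p' x hp' {hun hl hx hvx} => // t q IH y /= /andP[/andP[_ h] /IH{}IH].
  by rewrite inE => /orP[/eqP ->|].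
exists (rcons p' v); split; last by rewrite -rcons_cons mem_rcons inE -hl mem_last orbT.
split; last 1 first.
- rewrite -rcons_cons rcons_uniq hun andbT inE; apply/negP => /orP[/eqP hvx'|/(allP hav)].
    by move: hvx; rewrite -hvx' desc_refl //; lia.
  by rewrite desc_refl //; lia.
- rewrite rcons_path hl huv andbT; apply: sub_path hp' => y z /andP[] //.
- by rewrite last_rcons.
Qed.

(** [jordan_ge] turns the comparison of centralities into a lower bound on [weight s v], which
    [disjoint_weights] would contradict if [v] were not below [c]. *)
Lemma jordan_le_root s c v : valid s -> child s c ->
  (jordan (recursive_tree s) 1 <= weight s c)%N ->
  (1 < v < (size s).+2)%N ->
  (jordan (recursive_tree s) v <= jordan (recursive_tree s) 1)%N ->
  desc s c v && ((size s).+1 - weight s c <= weight s v)%N.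
Proof.
move=> hs hc h1 hv h2; have h3 := jordan_ge hs hv.
apply/andP; split; last lia.
have [//|hcv] := boolP (desc s c v).
have : (weight s v + weight s c < (size s).+1)%N by apply: disjoint_weights; lia.
lia.
Qed.

Lemma ranked_le_total G : total (ranked_le G).
Proof. by move=> x y; rewrite /ranked_le; lia. Qed.

Lemma ranked_le_trans G : transitive (ranked_le G).
Proof. by move=> x y z; rewrite /ranked_le; lia. Qed.

Lemma not_top_central s K : valid s -> 1%N \notin top_central K (recursive_tree s) ->
  (K <= count (fun v => ranked_le (recursive_tree s) v 1) (index_iota 2 (size s).+2))%N.
Proof.
move=> hs; set G := recursive_tree s.
rewrite !inE /= vertices_recursive_tree /= /position => h.
have {h} hK : (K <= index 1%N (ranking G))%N by lia.
have h1 : 1%N \in ranking G by rewrite mem_sort vertices_recursive_tree.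
have hun : uniq (ranking G) by rewrite sort_uniq fset_uniq.
rewrite -size_filter; apply: leq_trans hK _.
have hsz : (index 1 (ranking G) < size (ranking G))%N by rewrite index_mem.
have hst : size (take (index 1%N (ranking G)) (ranking G)) = index 1%N (ranking G).
  by rewrite size_takel // ltnW.
rewrite -hst; apply: uniq_leq_size; first by rewrite take_uniq.
move=> x hx; have hxr := mem_take hx.
have hix : (index x (ranking G) < index 1%N (ranking G))%N.
  exact: index_ltn hx.
have hx1 : x != 1%N by apply: contraTneq hix => ->; rewrite ltnn.
rewrite mem_filter mem_index_iota; apply/andP; split.
  apply: (@sorted_leq_index _ (ranked_le G) (@ranked_le_trans G) _ (ranking G)) => //; last exact: ltnW.
    by move=> z; rewrite /ranked_le eqxx leqnn orbT.
  exact: sort_sorted (@ranked_le_total G) _.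
by move: hxr; rewrite mem_sort vertices_recursive_tree; lia.
Qed.

Lemma not_top_central_child s K : valid s -> (0 < size s)%N ->
  1%N \notin top_central K (recursive_tree s) ->
  exists2 c, child s c &
    (K <= count (fun v => desc s c v && ((size s).+1 - weight s c <= weight s v)%N)
            (index_iota 2 (size s).+2))%N.
Proof.
move=> hs hsz /(not_top_central hs) hK.
have [c hc hle] := jordan_root_le hs hsz; exists c => //.
apply: leq_trans hK _; rewrite -!size_filter.
apply: uniq_leq_size; first by rewrite filter_uniq // iota_uniq.
move=> v; rewrite !mem_filter mem_index_iota => /andP[hr hv]; rewrite hv andbT.
by apply: jordan_le_root => //; move: hr; rewrite /ranked_le; lia.
Qed.

(** * Expectation over uniform attachments *)

Section Expectation.
Variable R : realFieldType.
Implicit Types (f g : seq nat -> R) (s t : seq nat).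

(** A finite average over parent choices, so that measure theory enters only when
    [probability_history] identifies it with the law of the tree. *)
Fixpoint expectation (s : seq nat) (k : nat) (f : seq nat -> R) : R :=
  if k is k'.+1 then
    (size s).+1%:R^-1 * \sum_(1 <= i < (size s).+2) expectation (i :: s) k' f
  else f s.

Lemma expectation_le s k f g : valid s ->
  (forall t, valid t -> size t = (size s + k)%N -> f t <= g t) ->
  expectation s k f <= expectation s k g.
Proof.
elim: k s => [|k IH] s hs hfg /=; first by apply: hfg; rewrite // addn0.
rewrite ler_pM2l ?invr_gt0 ?ltr0n // ler_sum_nat // => i hi.
apply: IH => [/=|t ht hsz]; first by rewrite hs andbT.
by apply: hfg => //; rewrite hsz /= addnS.
Qed.

Lemma expectationD s k f g :
  expectation s k (fun t => f t + g t) = expectation s k f + expectation s k g.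
Proof.
elim: k s => [|k IH] s //=; rewrite -mulrDr -big_split /=.
by congr (_ * _); apply: eq_bigr => i _.
Qed.

Lemma expectationZ s k c f :
  expectation s k (fun t => c * f t) = c * expectation s k f.
Proof.
elim: k s => [|k IH] s //=; rewrite mulrCA [in RHS]mulr_sumr.
by congr (_ * _); apply: eq_bigr => i _.
Qed.

Lemma expectation_add s a b f :
  expectation s (a + b) f = expectation s a (fun t => expectation t b f).
Proof.
elim: a s => [|a IH] s //=; congr (_ * _).
by apply: eq_bigr => i _; apply: IH.
Qed.

Lemma expectation_eq s k f g : valid s ->
  (forall t, valid t -> size t = (size s + k)%N -> f t = g t) ->
  expectation s k f = expectation s k g.
Proof.
move=> hs hfg; apply/eqP; rewrite eq_le; apply/andP; split;
  by apply: expectation_le => // t ht hsz; rewrite hfg.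
Qed.

Lemma expectation_cst s k (c : R) : expectation s k (fun=> c) = c.
Proof.
elim: k s => [|k IH] s //=.
under eq_bigr do rewrite IH.
rewrite sumr_const_nat subSS subn0 -(mulr_natl c) mulrA mulVf ?mul1r //.
Qed.

Lemma natr_weight s u : (weight s u)%:R = \sum_(1 <= v < (size s).+2) (desc s u v)%:R :> R.
Proof. by rewrite /weight natr_sum. Qed.

Lemma sum_desc s u (F : bool -> R) :
  \sum_(1 <= i < (size s).+2) F (desc s u i) =
  (weight s u)%:R * F true + ((size s).+1%:R - (weight s u)%:R) * F false.
Proof.
have h b : F b = F false + (F true - F false) * b%:R by case: b; rewrite ?mulr1 ?mulr0; ring.
under eq_bigr do rewrite h.
rewrite big_split /= -mulr_sumr -natr_weight sumr_const_nat subSS subn0 -mulr_natl.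
ring.
Qed.

(** A vertex below [v] is below [u], so only three of the four boolean pairs occur, and on these [F]
    is affine in the two indicators. *)
Lemma sum_desc2 s u v (F : bool -> bool -> R) : valid s -> desc s u v ->
  \sum_(1 <= i < (size s).+2) F (desc s v i) (desc s u i) =
  (weight s v)%:R * F true true +
  ((weight s u)%:R - (weight s v)%:R) * F false true +
  ((size s).+1%:R - (weight s u)%:R) * F false false.
Proof.
move=> hs huv.
have h i : F (desc s v i) (desc s u i) = F false false
     + (F true true - F false true) * (desc s v i)%:R
     + (F false true - F false false) * (desc s u i)%:R.
  case h1: (desc s v i); first by rewrite (desc_trans hs huv h1) !mulr1; ring.
  by case: (desc s u i); rewrite !(mulr1, mulr0); ring.
under eq_bigr do rewrite h.
rewrite !big_split /= -!mulr_sumr -!natr_weight sumr_const_nat subSS subn0 -mulr_natl.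
ring.
Qed.

(** * Subtree sizes of the children of the root *)

Definition child_sum s (F : nat -> R) : R :=
  \sum_(2 <= c < (size s).+2 | child s c) F (weight s c).

Lemma child_sum_cons i s F : valid s -> (0 < i < (size s).+2)%N ->
  child_sum (i :: s) F =
  \sum_(2 <= c < (size s).+2 | child s c) F (weight s c + desc s c i)%N
  + (i == 1%N)%:R * F 1%N.
Proof.
move=> hs hi; rewrite /child_sum big_mkcond big_nat_recr //=.
rewrite eqxx weight_new //; congr (_ + _); last first.
  by case: (i == 1%N); rewrite ?mul1r ?mul0r.
rewrite [RHS]big_mkcond; apply: eq_big_nat => c hc.
have -> : (c == (size s).+2) = false by lia.
by rewrite weight_old //; lia.
Qed.

Lemma child_sum_step s F : valid s ->
  \sum_(1 <= i < (size s).+2) child_sum (i :: s) F =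
  child_sum s (fun k => k%:R * F k.+1 + ((size s).+1%:R - k%:R) * F k) + F 1%N.
Proof.
move=> hs.
rewrite (@eq_big_nat _ _ _ _ _ _ (fun i =>
  \sum_(2 <= c < (size s).+2 | child s c) F (weight s c + desc s c i)%N
  + (i == 1%N)%:R * F 1%N)); last by move=> i hi; apply: child_sum_cons.
rewrite big_split /= exchange_big /=; congr (_ + _).
  apply: eq_bigr => c _.
  by rewrite (sum_desc s c (fun b => F (weight s c + b)%N)) addn1 addn0.
rewrite big_ltn // eqxx mul1r big_nat_cond big1 ?addr0 // => i hi.
by rewrite (_ : (i == 1%N) = false) ?mul0r //; lia.
Qed.

(** In the induction step the increments [F k.+1 - F k] telescope and the new child's [F 1] cancels
    the lower boundary term, leaving [F n.+1 / n.+1]. *)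
Lemma expectation_child_sum n F :
  expectation [::] n (fun s => child_sum s F) = \sum_(1 <= k < n.+1) F k / k%:R.
Proof.
elim: n F => [|n IH] F; first by rewrite /= /child_sum !big_geq.
rewrite -addn1 expectation_add addn1.
rewrite (@expectation_eq _ _ _ (fun s =>
   child_sum s (fun k => F k + n.+1%:R^-1 * (k%:R * (F k.+1 - F k))) + n.+1%:R^-1 * F 1%N)) //.
  rewrite expectationD expectation_cst IH [in RHS]big_nat_recr //=.
  rewrite (@eq_big_nat _ _ _ _ _ _ (fun k => F k / k%:R + n.+1%:R^-1 * (F k.+1 - F k))).
    rewrite big_split /= -mulr_sumr telescope_sumr //; field.
    by rewrite addrC natr1 pnatr_eq0.
  move=> k hk; field.
  by rewrite addrC natr1 !pnatr_eq0 /=; lia.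
move=> s hs /= hsz; rewrite child_sum_step // hsz add0n mulrDr; congr (_ + _).
rewrite /child_sum mulr_sumr; apply: eq_bigr => c _; field.
by rewrite addrC natr1 pnatr_eq0.
Qed.

End Expectation.

(** * A supermartingale for the overtaking vertices *)

Section Potential.
Variable R : realFieldType.

(* The probability that the [b]-th head of a fair coin comes before its [w]-th
   tail, which is also the probability that a Beta(w, b) variable, the limiting
   proportion of a Polya urn started from [w] and [b] balls, exceeds 1/2; hence
   the martingale property [overtake_harmonic]. *)
Fixpoint overtake (w : nat) : nat -> R :=
  if w is w'.+1 then
    fix overtake_w b := if b is b'.+1 then (overtake w' b + overtake_w b') / 2 else 1
  else fun=> 0.

Lemma overtakeSS w b :
  overtake w.+1 b.+1 = (overtake w b.+1 + overtake w.+1 b) / 2.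
Proof. by []. Qed.

Lemma overtake_ge0 w b : 0 <= overtake w b.
Proof.
elim: w b => [|w IH] b //; elim: b => [|b IHb] //; rewrite overtakeSS.
by rewrite divr_ge0 // addr_ge0.
Qed.

Lemma overtake1 b : overtake 1 b = 2^-1 ^+ b.
Proof.
by elim: b => [|b IH] //; rewrite overtakeSS IH add0r exprSr.
Qed.

(** After exchanging heads and tails, the two terms are probabilities of complementary events. *)
Lemma overtake_sym w b : (0 < w + b)%N -> overtake w b + overtake b w = 1.
Proof.
move: {2}(w + b)%N (leqnn (w + b)) => n; elim: n w b => [|n IH] [|w] [|b] //=; try lia.
- by move=> _ _; rewrite add0r.
- by move=> _ _; rewrite addr0.
move=> hn _; rewrite -!/(overtake _ _).
have h1 : overtake w b.+1 + overtake b.+1 w = 1 by apply: IH; lia.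
have h2 : overtake w.+1 b + overtake b w.+1 = 1 by apply: IH; lia.
move: h1 h2; rewrite /=; lra.
Qed.

Lemma overtake_leS w b : overtake w b <= overtake w.+1 b.
Proof.
elim: w b => [|w IH] b; first exact: overtake_ge0.
elim: b => [|b IHb] //; rewrite !overtakeSS.
have := IH b.+1; have := IH b; rewrite !overtakeSS.
move: IHb; lra.
Qed.

(** For positive [b], symmetry gives [overtake b b = 1/2], and [overtake] grows with [w]. *)
Lemma overtake_half w b : (0 < w)%N -> (b <= w)%N -> 2^-1 <= overtake w b.
Proof.
move=> hw hbw.
have h : overtake b b <= overtake w b.
  rewrite -(subnK hbw) addnC; elim: (w - b)%N => [|n IH]; first by rewrite addn0.
  by rewrite addnS; apply: le_trans IH (overtake_leS _ _).
case: b hbw h => [|b] hbw h; first by case: w hw {h hbw} => // w _; rewrite /=; lra.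
have := @overtake_sym b.+1 b.+1 isT; move: h; lra.
Qed.

Lemma overtake_harmonic w b : (0 < w + b)%N ->
  (w + b)%:R * overtake w b = w%:R * overtake w.+1 b + b%:R * overtake w b.+1.
Proof.
(* Induction on a bound for [w + b]: the recurrence combines the identities at [(w, b.+1)] and
   [(w.+1, b)], which have the same smaller total. *)
move: {2}(w + b)%N (leqnn (w + b)) => n; elim: n w b => [|n IH] w b; first lia.
case: w => [|w]; first by move=> _ _; rewrite !mulr0 mul0r addr0.
case: b => [|b]; first by move=> _ _; rewrite mul0r addr0 addn0.
move=> hn _; rewrite (overtakeSS w.+1 b) (overtakeSS w b.+1).
have h1 : (w + b.+1)%:R * overtake w b.+1 = w%:R * overtake w.+1 b.+1 + b.+1%:R * overtake w b.+2.
  by apply: IH; lia.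
have h2 : (w.+1 + b)%:R * overtake w.+1 b = w.+1%:R * overtake w.+2 b + b%:R * overtake w.+1 b.+1.
  by apply: IH; lia.
have h3 := overtakeSS w b.
move: h1 h2 h3; rewrite !natrD -[w.+1%:R]natr1 -[b.+1%:R]natr1.
move: (overtake w b.+1) (overtake w.+1 b) (overtake w.+1 b.+1) (overtake w b.+2) (overtake w.+2 b).
move: (w%:R : R) (b%:R : R) => x y p q r u v h1 h2 h3.
have h4 : (x + y + 1) * r = (x + y + 1) * (p + q) / 2 by rewrite h3 mulrA.
move: h1 h2 h4; lra.
Qed.

Local Arguments overtake : simpl never.

(* With [b = n + 1 - k] vertices outside a block of size [k], this is
   [n 2^(1-b) / (b-1)], the solution of the recurrence under which one
   attachment step lowers it on average by exactly [2^-b]. The value at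
   [k = n] ([b = 1]) is the junk [n / 0 = 0]. *)
Definition block_term (n k : nat) : R := n%:R / ((n - k)%:R * 2 ^+ (n - k)).

(** The inner sum has at most one term, for the child [c] of the root above [v]; it is the urn
    probability that the descendants of [v] end up outnumbering the vertices outside the subtree of
    [c]. *)
Definition overtake_sum (l : nat) (s : seq nat) : R :=
  \sum_(l <= v < (size s).+2)
    \sum_(2 <= c < (size s).+2 | child s c && desc s c v)
      overtake (weight s v) ((size s).+1 - weight s c).

(* The last term pays for the blocks created after the initial time. *)
Definition potential (l : nat) (s : seq nat) : R :=
  overtake_sum l s + child_sum s (block_term (size s)) + 4 * 2^-1 ^+ size s.

Lemma overtake_sum_ge0 l s : 0 <= overtake_sum l s.
Proof. by apply: sumr_ge0 => v _; apply: sumr_ge0 => c _; apply: overtake_ge0. Qed.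

Lemma block_term_ge0 n k : 0 <= block_term n k.
Proof. by rewrite /block_term divr_ge0 // mulr_ge0 // exprn_ge0. Qed.

Lemma child_sum_ge0 s (F : nat -> R) : (forall k, 0 <= F k) -> 0 <= child_sum s F.
Proof. by move=> hF; apply: sumr_ge0. Qed.

Lemma weight_desc_le s u v : valid s -> desc s u v -> (weight s v <= weight s u)%N.
Proof.
move=> hs huv; rewrite /weight; apply: leq_sum => x _.
by case h: (desc s v x) => //; rewrite (desc_trans hs huv h).
Qed.

Lemma weight_child_le s c : valid s -> child s c -> (weight s c <= size s)%N.
Proof.
move=> hs hc; rewrite /weight big_ltn // child_desc_root // add0n.
apply: (@leq_trans (\sum_(2 <= x < (size s).+2) 1)); last first.
  by rewrite sum_nat_const_nat; lia.
by apply: leq_sum => x _; apply: leq_b1.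
Qed.

(** The three sums are the old vertices with updated counts, the new vertex inside an existing
    child's subtree, and the new vertex as a child of the root. *)
Lemma overtake_sum_cons l i s : valid s -> (0 < i < (size s).+2)%N ->
  (1 < l <= (size s).+2)%N ->
  overtake_sum l (i :: s) =
    \sum_(l <= v < (size s).+2)
      \sum_(2 <= c < (size s).+2 | child s c && desc s c v)
        overtake (weight s v + desc s v i) ((size s).+2 - (weight s c + desc s c i))
  + \sum_(2 <= c < (size s).+2 | child s c)
      (desc s c i)%:R * overtake 1 ((size s).+1 - weight s c)
  + (i == 1%N)%:R * overtake 1 (size s).+1.
Proof.
move=> hs hi hl; rewrite /overtake_sum big_nat_recr /=; last lia.
rewrite -addrA; congr (_ + _).
  apply: eq_big_nat => v hv; rewrite big_mkcond big_nat_recr //=.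
  have -> : (v == (size s).+2) = false by lia.
  rewrite desc_new // andbF addr0 [RHS]big_mkcond; apply: eq_big_nat => c hc.
  have -> : (c == (size s).+2) = false by lia.
  by rewrite !weight_old //; lia.
rewrite big_mkcond big_nat_recr //= !eqxx orTb andbT weight_new // subn1 /=.
congr (_ + _); last by case: (i == 1%N); rewrite ?mul1r ?mul0r.
rewrite [RHS]big_mkcond; apply: eq_big_nat => c hc.
have -> : (c == (size s).+2) = false by lia.
case: (child s c) => //=; rewrite weight_old //; last lia.
case: (desc s c i); rewrite ?mul1r ?mul0r //.
by rewrite addn1 subSS.
Qed.

(** For old vertices the mean is preserved by [overtake_harmonic]: parents below [c] but not below
    [v] leave both urn counts unchanged. Only the new vertex adds to the sum, with
    [overtake 1 b = 2^-b]. *)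
Lemma overtake_sum_step l s : valid s -> (1 < l <= (size s).+2)%N ->
  \sum_(1 <= i < (size s).+2) overtake_sum l (i :: s) =
  (size s).+1%:R * overtake_sum l s
  + child_sum s (fun k => k%:R * 2^-1 ^+ ((size s).+1 - k)) + 2^-1 ^+ (size s).+1.
Proof.
move=> hs hl.
rewrite (eq_big_nat _ _ (fun i hi => overtake_sum_cons hs hi hl)) !big_split /=.
congr (_ + _ + _).
- rewrite /overtake_sum exchange_big /= mulr_sumr; apply: eq_big_nat => v hv.
  rewrite exchange_big /= mulr_sumr; apply: eq_bigr => c /andP[hc hcv].
  rewrite (sum_desc2 (fun b b' => overtake (weight s v + b) ((size s).+2 - (weight s c + b'))) hs hcv).
  have h1 := weight_desc_le hs hcv; have h2 := weight_child_le hs hc.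
  have h3 : (0 < weight s v)%N.
    rewrite /weight (big_rem v) /=; last by rewrite mem_index_iota; lia.
    by rewrite desc_refl //; lia.
  rewrite !addn1 !addn0 subSS.
  have [b hb] : exists b, (size s).+1 = (weight s c + b)%N.
    by exists ((size s).+1 - weight s c)%N; lia.
  have -> : ((size s).+2 - weight s c)%N = b.+1 by lia.
  have -> : ((size s).+1 - weight s c)%N = b by lia.
  have -> : (size s).+1%:R = (weight s c)%:R + b%:R :> R by rewrite hb natrD.
  have := @overtake_harmonic (weight s v) b; rewrite natrD => hh.
  have {}hh := hh ltac:(lia).
  move: hh; lra.
- rewrite exchange_big /=; apply: eq_bigr => c _.
  by rewrite -mulr_suml -natr_weight overtake1.
- rewrite big_ltn // eqxx mul1r overtake1 big_nat_cond big1 ?addr0 // => i hi.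
  by rewrite (_ : (i == 1%N) = false) ?mul0r //; lia.
Qed.

(* At least two vertices lie outside the subtree of each child of the root. *)
Definition spread (s : seq nat) : Prop :=
  forall c, child s c -> (weight s c < size s)%N.

(** The number of vertices outside a given child's subtree never decreases, and a new child starts
    with weight 1. *)
Lemma spread_cons s i : valid s -> (0 < i < (size s).+2)%N -> (0 < size s)%N ->
  spread s -> spread (i :: s).
Proof.
move=> hs hi hn hsp c /=; case: eqP => [-> _|_ hc]; first by rewrite weight_new.
rewrite weight_old //; last by have := child_bounds hc; lia.
by have := hsp c hc; case: desc; lia.
Qed.

Lemma potential_step l s : valid s -> (1 < l <= (size s).+2)%N ->
  (0 < size s)%N -> spread s ->
  (size s).+1%:R^-1 * \sum_(1 <= i < (size s).+2) potential l (i :: s)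
    <= potential l s.
Proof.
move=> hs hl hn hsp; rewrite mulrC ler_pdivrMr ?ltr0n //.
rewrite /potential !big_split /= overtake_sum_step // child_sum_step //.
rewrite sumr_const_nat subSS subn0.
set n := size s in hn *.
have h1 : child_sum s (fun k => k%:R * 2^-1 ^+ (n.+1 - k))
   + child_sum s (fun k => k%:R * block_term n.+1 k.+1 + (n.+1%:R - k%:R) * block_term n.+1 k)
   <= n.+1%:R * child_sum s (block_term n).
  rewrite /child_sum -big_split /= mulr_sumr big_mkcond [leRHS]big_mkcond /=.
  apply: ler_sum => c _; case: ifP => // hc.
  have hw := hsp c hc; rewrite -/n in hw.
  (* [spread] keeps the denominator of [block_term n] nonzero. *)
  have [j hj] : exists j, n = (weight s c + j.+1)%N.
    by exists (n - weight s c).-1; lia.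
  rewrite /block_term subSS.
  have -> : (n.+1 - weight s c)%N = j.+2 by lia.
  have -> : (n - weight s c)%N = j.+1 by lia.
  rewrite hj exprVn !exprS.
  have he : (2 : R) ^+ j != 0 by rewrite expf_neq0.
  have hx : 0 <= (weight s c)%:R :> R by [].
  have hj0 : 0 <= j%:R :> R by [].
  (* With [b = j + 2], the total decrease of the block term is [(n + 1) 2^-b]. The new vertex
     consumes [k 2^-b] of it, where [k] is the weight of [c], and the slack is [b 2^-b]. *)
  rewrite -subr_ge0 [X in 0 <= X](_ : _ = (j%:R + 2) / (4 * 2 ^+ j)).
    by rewrite divr_ge0 ?addr_ge0 // mulr_ge0 // exprn_ge0.
  by field; rewrite he !lt0r_neq0 // ltr_pwDl.
set y := 2^-1 ^+ n.
have hy : 0 < y by rewrite exprn_gt0 // invr_gt0.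
have hnR : 1 <= n%:R :> R by rewrite ler1n.
have hb : block_term n.+1 1 <= 2 * y.
  rewrite /block_term subSS subn0 invfM mulrA -exprVn -/y ler_pM2r //.
  by rewrite ler_pdivrMr ?ltr0n // -natr1; lra.
have hny : y <= n%:R * y by rewrite ler_peMl // ltW.
(* A new child costs at most [y / 2 + 2 y], while halving the term [4 y] releases [2 (n + 1) y] over
   the [n + 1] choices. *)
rewrite exprS -/y -[4 * _ *+ n.+1]mulr_natl -[n.+1%:R]natr1.
rewrite -[n.+1%:R]natr1 in h1.
move: h1 hb hny hy.
move: (child_sum s (fun k => k%:R * 2^-1 ^+ (n.+1 - k))) => A.
move: (child_sum s (fun k => k%:R * block_term n.+1 k.+1 + (n%:R + 1 - k%:R) * block_term n.+1 k)) => B.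
move: (block_term n.+1 1) (child_sum s _) (overtake_sum l s) => b C Q.
move: y n%:R => y N; clear; lra.
Qed.

Lemma expectation_potential l s k : valid s -> (1 < l <= (size s).+2)%N ->
  (0 < size s)%N -> spread s -> expectation s k (potential l) <= potential l s.
Proof.
elim: k s => [|k IH] s hs hl hn hsp //=.
apply: le_trans (potential_step hs hl hn hsp).
rewrite ler_pM2l ?invr_gt0 ?ltr0n // ler_sum_nat // => i hi.
apply: IH => /=; rewrite ?hs ?andbT //; [lia|exact: spread_cons].
Qed.

(** * From the potential to the failure probability *)

Definition failure (K : nat) (s : seq nat) : R :=
  (1%N \notin top_central K (recursive_tree s))%:R.

(** A Markov-type bound: of the [K] vertices given by [not_top_central_child], at most [a] are among
    the vertices 2 to [a + 1]; each of the others contributes at least 1/2 by [overtake_half]. *)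
Lemma failure_le a K s : valid s -> (0 < a <= size s)%N -> (a < K)%N ->
  failure K s <= 2 / (K - a)%:R * overtake_sum a.+2 s.
Proof.
move=> hs ha haK; rewrite /failure.
have hKa : 0 < (K - a)%:R :> R by rewrite ltr0n; lia.
have [h|_] := boolP (1%N \notin top_central K (recursive_tree s)); last first.
  by rewrite mulr_ge0 ?overtake_sum_ge0 // divr_ge0.
rewrite -[2 / _]invf_div mulrC ler_pdivlMr ?divr_gt0 // mul1r.
have [|c hc hK] := not_top_central_child hs _ h; first by lia.
move: hK; rewrite /index_iota (_ : (size s).+2 - 2 = a + (size s - a))%N; last lia.
rewrite iotaD count_cat => hK.
have {}hK : (K - a <= count (fun v => desc s c v && ((size s).+1 - weight s c <= weight s v)%N)
   (iota a.+2 (size s - a)))%N.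
  have := count_size (fun v => desc s c v && ((size s).+1 - weight s c <= weight s v)%N) (iota 2 a).
  by rewrite size_iota; move: hK; rewrite add2n; lia.
rewrite mulrC.
have hsum : 2^-1 * (K - a)%:R <= \sum_(a.+2 <= v < (size s).+2)
    2^-1 * (desc s c v && ((size s).+1 - weight s c <= weight s v)%N)%:R :> R.
  rewrite -mulr_sumr ler_pM2l ?invr_gt0 // -natr_sum ler_nat.
  apply: leq_trans hK _; rewrite -sum1_count big_mkcond /index_iota !subSS.
  by apply: leq_sum => v _; case: ifP.
apply: le_trans hsum _; apply: ler_sum_nat => v hv.
rewrite big_mkcond (bigD1_seq c) ?iota_uniq //=; last first.
  by rewrite mem_index_iota; have := child_bounds hc; lia.
rewrite hc /= -[leLHS]addr0; apply: lerD; last first.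
  by apply: sumr_ge0 => c' _; case: ifP => // _; apply: overtake_ge0.
case hcv: (desc s c v) => /=; last by rewrite mulr0.
case hle: (_ <= _)%N; last by rewrite mulr0 overtake_ge0.
by rewrite mulr1 overtake_half //; have := weight_child_le hs hc; lia.
Qed.

Lemma failure_expectation_spread a K k s : valid s -> size s = a -> (0 < a < K)%N ->
  spread s ->
  expectation s k (failure K) <=
    2 / (K - a)%:R * (child_sum s (block_term a) + 4 * 2^-1 ^+ a).
Proof.
move=> hs hsz haK hsp.
apply: (@le_trans _ _ (expectation s k (fun t => 2 / (K - a)%:R * potential a.+2 t))).
  apply: expectation_le => // t ht htsz.
  apply: (le_trans (@failure_le a K t ht _ _)); try lia.
  rewrite ler_wpM2l ?divr_ge0 // /potential -addrA lerDl addr_ge0 //.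
  by apply: child_sum_ge0; apply: block_term_ge0.
rewrite expectationZ ler_wpM2l ?divr_ge0 //.
apply: (le_trans (expectation_potential k hs _ _ hsp)); try lia.
(* At the initial time no vertex has label [a + 2] or more, so the overtaking sum is empty. *)
by rewrite /potential /overtake_sum hsz big_geq // add0r.
Qed.

Lemma sum_halves a : (0 < a)%N ->
  \sum_(1 <= j < a) 2^-1 ^+ (a - j) = 1 - 2 * 2^-1 ^+ a :> R.
Proof.
elim: a => // -[_ _|a IH _]; first by rewrite big_geq // expr1 mulfV ?subrr.
rewrite big_nat_recr //= subSnn expr1 exprS.
rewrite (eq_big_nat _ _ (F2 := fun j => 2^-1 * 2^-1 ^+ (a.+1 - j))); last first.
  by move=> j hj; rewrite subSn ?exprS //; lia.
by rewrite -mulr_sumr IH //; lra.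
Qed.

(** With [i = a - j], the inequality [i + j <= 2 i j] bounds each term by [2 * 2^-i]; the term
    [j = a] is the default value 0. *)
Lemma sum_block_term a : (0 < a)%N ->
  \sum_(1 <= j < a.+1) block_term a j / j%:R <= 2.
Proof.
move=> ha; rewrite big_nat_recr //= [block_term a a]/block_term subnn mul0r invr0 mulr0 mul0r addr0.
apply: (@le_trans _ _ (\sum_(1 <= j < a) 2 * 2^-1 ^+ (a - j))).
  apply: ler_sum_nat => j hj; rewrite /block_term.
  have [i hi] : exists i, a = (i + j)%N by exists (a - j)%N; lia.
  have {}hi0 : (0 < i)%N by lia.
  rewrite hi addnK invfM mulrA mulrAC exprVn ler_pM2r ?invr_gt0 ?exprn_gt0 //.
  rewrite -mulrA -invfM ler_pdivrMr ?mulr_gt0 ?ltr0n //; last lia.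
  have h1 : 1 <= i%:R :> R by rewrite ler1n.
  have h2 : 1 <= j%:R :> R by rewrite ler1n; lia.
  by rewrite natrD; nra.
by rewrite -mulr_sumr sum_halves // -[leRHS]mulr1 ler_pM2l // lerBlDr lerDl mulr_ge0 // exprn_ge0 // invr_ge0.
Qed.

(** Split on the tree with [a + 1] vertices: without [spread], some child has all [a] other vertices
    below it and failure is bounded by 1. One [child_sum] dominates both cases, and its mean is
    known exactly. *)
Lemma expectation_failure_le a K k : (1 < a < K)%N ->
  expectation [::] (a + k) (failure K) <= a%:R^-1 + 6 / (K - a)%:R.
Proof.
move=> haK; rewrite expectation_add.
have hKa : 0 < (K - a)%:R :> R by rewrite ltr0n; lia.
set C : R := 2 / (K - a)%:R.
have hC : 0 <= C by rewrite divr_ge0.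
have hr : 0 <= 4 * 2^-1 ^+ a :> R by rewrite mulr_ge0 // exprn_ge0 // invr_ge0.
apply: (@le_trans _ _ (expectation [::] a (fun s =>
    child_sum s (fun j => (a <= j)%:R + C * block_term a j) + C * (4 * 2^-1 ^+ a)))).
  apply: expectation_le => // s hs /= hsz; rewrite add0n in hsz.
  have hF k' : 0 <= C * block_term a k' by rewrite mulr_ge0 // block_term_ge0.
  have [hsp|hsp] := pselect (spread s).
    apply: (le_trans (failure_expectation_spread k hs hsz _ hsp)); first by lia.
    rewrite mulrDr lerD2r /child_sum mulr_sumr; apply: ler_sum => c _.
    by rewrite lerDr.
  have [c hc hw] : exists2 c, child s c & (a <= weight s c)%N.
    apply: contrapT => h; apply: hsp => c hc; rewrite hsz ltnNge; apply/negP => hw.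
    by apply: h; exists c.
  apply: (@le_trans _ _ 1).
    rewrite -[leRHS](expectation_cst s k); apply: expectation_le => // t _ _.
    by rewrite /failure; case: (_ \notin _).
  rewrite -[leLHS]addr0; apply: lerD; last by rewrite mulr_ge0.
  rewrite /child_sum big_mkcond (bigD1_seq c) ?iota_uniq //=; last first.
    by rewrite mem_index_iota; have := child_bounds hc; lia.
  rewrite hc hw -addrA lerDl addr_ge0 //.
  by apply: sumr_ge0 => c' _; case: ifP => // _; rewrite addr_ge0.
rewrite expectationD expectation_cst expectation_child_sum.
under eq_bigr do rewrite mulrDl -mulrA.
rewrite big_split /= -mulr_sumr big_nat_recr //=; last lia.
rewrite leqnn mul1r big_nat_cond big1 ?add0r; last first.
  by move=> j hj; rewrite leqNgt (_ : (j < a)%N) ?mul0r //; lia.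
rewrite -addrA lerD2l -mulrDr (_ : 6 / (K - a)%:R = C * 3); last by rewrite /C; field; lra.
(* The 2 bounds the block terms, and the 1 bounds [4 * 2^-a] since [a >= 2]. *)
rewrite ler_wpM2l // (_ : 3 = 2 + 1); last by ring.
apply: lerD; first by apply: sum_block_term; lia.
have : 2^-1 ^+ a <= 2^-1 ^+ 2 :> R by rewrite ler_wiXn2l //; [lra|lia].
by rewrite expr2; lra.
Qed.

End Potential.

(** * The law of the uniform random recursive tree *)

(** The latest vertex is a leaf attached to its parent, so the parent list can be read off the edges
    from the last vertex backwards. *)
Lemma adjacent_inj s t : valid s -> valid t -> size s = size t ->
  adjacent (recursive_tree s) =2 adjacent (recursive_tree t) -> s = t.
Proof.
elim: s t => [|i s IH] [|j t] //= /andP[hi hs] /andP[hj ht] [hst] hadj.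
have old r x : valid r -> adjacent (recursive_tree r) x (size r).+2 = false.
  by move=> hr; apply/negP => /(adjacent_bounds hr); lia.
have hij : i = j.
  have := hadj i (size s).+2.
  rewrite !adjacent_recursive_tree hst [in RHS]old // !eqxx /=.
  by rewrite andbT; lia.
congr (_ :: _) => //; apply: IH => // x y; have := hadj x y.
rewrite !adjacent_recursive_tree hij hst.
have [hx|hx] := boolP ((x < (size t).+2)%N && (y < (size t).+2)%N).
  by rewrite ![_ == (size t).+2]ltn_eqF ?andbF //; lia.
move=> _; apply/idP/idP => [/(adjacent_bounds hs)|/(adjacent_bounds ht)];
  move: hx; rewrite ?hst; lia.
Qed.

Section History.
Context d (Omega : measurableType d) (R : realType) (P : probability Omega R).
Variables (T : nat -> Omega -> graph) (I : nat -> {RV P >-> nat}).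
Hypothesis T1 : forall w, T 1%N w = single_vertex.
Hypothesis TI : forall n, (0 < n)%N ->
    [/\ forall w, (1 <= I n w <= n)%N,
        forall i, (1 <= i <= n)%N -> P [set w | I n w = i]%classic = (n%:R^-1)%:E,
        forall (i : nat) (t : nat -> graph),
          P ([set w | I n w = i] `&`
             [set w | forall k, (1 <= k <= n)%N -> T k w = t k])%classic =
          (P [set w | I n w = i]%classic *
          P [set w | forall k, (1 <= k <= n)%N -> T k w = t k]%classic)%E
      & forall w, T n.+1 w = attach (T n w) (I n w) n.+1].

Fixpoint history (n : nat) (w : Omega) : seq nat :=
  if n is n'.+1 then I n w :: history n' w else [::].

Lemma size_history n w : size (history n w) = n.
Proof. by elim: n => //= n ->. Qed.

Lemma valid_history n w : valid (history n w).
Proof.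
elim: n => //= n ->; rewrite andbT size_history.
by have [h _ _ _] := TI (ltn0Sn n); apply: h.
Qed.

Lemma recursive_tree_history n w : T n.+1 w = recursive_tree (history n w).
Proof.
elim: n => [|n IH] //=; have [_ _ _ ->] := TI (ltn0Sn n).
by rewrite IH size_history.
Qed.

Lemma drop_history n k w : (k <= n)%N -> history k w = drop (n - k) (history n w).
Proof.
elim: n => [|n IH]; first by rewrite leqn0 => /eqP ->.
rewrite leq_eqVlt => /orP[/eqP -> |hk]; first by rewrite subnn drop0.
by rewrite subSn // IH.
Qed.

(* Independence is assumed only on the events [T 1 = t 1, ..., T n = t n], so
   the events [history n = s] have to be recognized among them. *)
Lemma history_event n s : valid s -> size s = n ->
  [set w | history n w = s]%classic =
  [set w | forall k, (1 <= k <= n.+1)%N ->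
     T k w = recursive_tree (drop (n.+1 - k) s)]%classic.
Proof.
move=> hs hsz; apply/seteqP; split => w /= h.
  move=> [|k] // hk; rewrite recursive_tree_history subSS -h.
  by rewrite (@drop_history n).
have := h n.+1; rewrite ltnSn subnn drop0 recursive_tree_history => /(_ isT) hT.
apply: adjacent_inj; rewrite ?hT ?valid_history ?size_history //.
Qed.

Lemma measurable_choice n i : measurable [set w | I n w = i]%classic.
Proof.
by rewrite -[X in measurable X]setTI; apply: (@measurable_funPT _ _ _ _ (I n) measurableT [set i]%classic).
Qed.

Lemma measurable_history n (Q : pred (seq nat)) :
  measurable [set w | Q (history n w)]%classic.
Proof.
elim: n Q => [|n IH] Q /=.
  case: (Q [::]); first by rewrite (_ : mkset _ = setT) //; apply/seteqP; split.
  by rewrite (_ : mkset _ = set0) //; apply/seteqP; split.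
rewrite (_ : mkset _ = \bigcup_i ([set w | I n.+1 w = i] `&` [set w | Q (i :: history n w)]))%classic.
  by apply: bigcupT_measurable => i; apply: measurableI; [apply: measurable_choice|apply: (IH (fun s => Q (i :: s)))].
apply/seteqP; split => w /=; first by exists (I n.+1 w).
by move=> [i _ [<-]].
Qed.

Lemma measurable_history_eq n s : measurable [set w | history n w = s]%classic.
Proof.
rewrite (_ : mkset _ = [set w | history n w == s])%classic.
  exact: (measurable_history n (pred1 s)).
by apply/seteqP; split => w /= /eqP.
Qed.

Lemma probability_history_cons n i s : valid (i :: s) -> size s = n ->
  P [set w | history n.+1 w = i :: s]%classic =
  ((n.+1%:R^-1)%:E * P [set w | history n w = s]%classic)%E.
Proof.
move=> hv hsz; have := hv => /= /andP[hi hs].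
have [_ h1 h2 _] := TI (ltn0Sn n).
rewrite -(h1 i); last by rewrite -hsz; lia.
rewrite history_event // -h2 -history_event //; congr (P _).
by apply/seteqP; split => w /= [-> ->].
Qed.

(** The law conditioned on the history [s], in product form to avoid dividing by its probability.
    The induction on [k] splits on the next parent. *)
Lemma probability_history_from s k (Q : pred (seq nat)) : valid s ->
  P ([set w | Q (history (size s + k) w)] `&` [set w | history (size s) w = s])%classic =
  ((expectation s k (fun t => (Q t)%:R : R))%:E * P [set w | history (size s) w = s]%classic)%E.
Proof.
elim: k s => [|k IH] s hs /=.
  rewrite addn0; case hQ: (Q s) => /=.
    rewrite mul1e; congr (P _); apply/seteqP; split => w /= ; first by case.
    by move=> h; rewrite h hQ.
  rewrite mul0e -[RHS](measure0 P); congr (P _); apply/seteqP; split => w //= [h1 h2].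
  by rewrite h2 hQ in h1.
pose F i := ([set w | Q (history (size (i.+1 :: s) + k) w)] `&`
    [set w | history (size (i.+1 :: s)) w = i.+1 :: s])%classic.
have -> : ([set w | Q (history (size s + k.+1) w)] `&` [set w | history (size s) w = s] =
    \big[setU/set0]_(i < (size s).+1) F i)%classic.
  rewrite -bigcup_mkord; apply/seteqP; split => w; rewrite addnS /F /=.
    move=> [h1 h2].
    have := valid_history (size s).+1 w; rewrite /= h2 => /andP[hI _].
    exists (I (size s).+1 w).-1 => /=; first by lia.
    by rewrite h2 prednK; [split|lia].
  by move=> [i _ /= [h1 [_ h2]]].
rewrite measure_bigsetU //=; last 2 first.
- by move=> i; apply: measurableI; [apply: measurable_history|apply: measurable_history_eq].
- apply/trivIsetP => i j _ _ hij; apply/seteqP; split => w //= [[_ [h1 _]] [_ [h2 _]]].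
  by case/eqP: hij; move: h1; rewrite h2 => -[].
rewrite (eq_bigr (fun i : 'I_(size s).+1 => ((expectation (i.+1 :: s) k (fun t => (Q t)%:R : R))%:E *
   (((size s).+1%:R^-1)%:E * P [set w | history (size s) w = s]%classic))%E)); last first.
  move=> i _; have hv : valid (i.+1 :: s) by rewrite /= hs andbT ltnS ltn_ord.
  by rewrite -(probability_history_cons hv erefl) -IH.
rewrite -(fineK (fin_num_measure P _ (measurable_history_eq (size s) s))).
under eq_bigr do rewrite -!EFinM.
rewrite sumEFin -EFinM; congr EFin.
rewrite -mulr_suml big_add1 /= big_mkord; ring.
Qed.

Lemma probability_history n (Q : pred (seq nat)) :
  P [set w | Q (history n w)]%classic =
  (expectation [::] n (fun t => (Q t)%:R : R))%:E.
Proof.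
have := @probability_history_from [::] n Q isT; rewrite add0n /=.
rewrite (_ : [set w | [::] = [::]] = setT)%classic; last by apply/seteqP; split.
by rewrite probability_setT mule1 setIT.
Qed.

Lemma probability_top_central_ge (a K n : nat) : (1 < a < K)%N -> (a < n)%N ->
  ((1 - (a%:R^-1 + 6 / (K - a)%:R))%:E <=
    P [set w | 1%N \in top_central K (T n w)]%classic)%E.
Proof.
case: n => // n haK han.
rewrite (_ : mkset _ = [set w | 1%N \in top_central K (recursive_tree (history n w))])%classic; last first.
  by apply/seteqP; split => w /=; rewrite recursive_tree_history.
rewrite (probability_history n (fun s => 1%N \in top_central K (recursive_tree s))) lee_fin.
rewrite lerBlDr -[leLHS](expectation_cst [::] n (1 : R)).
apply: (@le_trans _ _ (expectation [::] n (fun s =>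
   (1%N \in top_central K (recursive_tree s))%:R + failure R K s))).
  by apply: expectation_le => // s _ _; rewrite /failure; case: (1%N \in _); rewrite ?addr0 ?add0r.
rewrite expectationD lerD2l -(subnKC (_ : (a <= n)%N)) //.
exact: expectation_failure_le.
Qed.

End History.

Theorem corollary11 (d : measure_display) (Omega : measurableType d)
    (R : realType) (P : probability Omega R) (T : nat -> Omega -> graph)
    (hT : is_URRT P T) (eps : R) (heps : (0 < eps)%R)
    (K : nat) (hK0 : (0 < K)%N) (hK : (66%:R / eps <= K%:R)%R) :
  ((1 - eps)%:E <=
     limn_einf (fun n : nat => P [set w : Omega | 1%N \in top_central K (T n w)]%classic))%E.
Proof.
have [T1 [I TI]] := hT.
(* A bound for all large [n] passes to the infima over tails, whose limit is the limit inferior. *)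
suff [N hN] : exists N, forall n, (N <= n)%N ->
    ((1 - eps)%:E <= P [set w : Omega | 1%N \in top_central K (T n w)]%classic)%E.
  rewrite limn_einf_lim; apply: lime_ge; first exact: is_cvg_einfs.
  exists N => // n /= hn; apply: le_ereal_inf_tmp => _ [k /= hk <-].
  by apply: hN; apply: leq_trans hn hk.
have [heps1|heps1] := leP 1 eps.
  exists 0%N => n _; apply: (@le_trans _ _ 0%E); last exact: measure_ge0.
  by rewrite lee_fin subr_le0.
have hKeps : 66 <= K%:R * eps by rewrite -ler_pdivrMr.
have hK66 : (66 < K)%N by rewrite -(ltr_nat R); nra.
exists (K./2).+1 => n hn.
apply: le_trans (probability_top_central_ge T1 TI (a := K./2) _ hn); last by lia.
rewrite lee_fin lerD2l lerN2.
(* Replacing [K / 2] by [K / 3] absorbs the rounding of [K./2]; the failure bound becomes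
   [7 * 3 / K = 21 / K], below [66 / K]. *)
have h1 : K%:R / 3 <= (K./2)%:R :> R by rewrite ler_pdivrMr // -natrM ler_nat; lia.
have h2 : K%:R / 3 <= (K - K./2)%:R :> R by rewrite ler_pdivrMr // -natrM ler_nat; lia.
have hc : 0 < (K%:R / 3)^-1 :> R by rewrite invr_gt0 divr_gt0 // ltr0n.
have h3 : (K./2)%:R^-1 <= (K%:R / 3)^-1 :> R by rewrite lef_pV2 // posrE; nra.
have h4 : (K - K./2)%:R^-1 <= (K%:R / 3)^-1 :> R by rewrite lef_pV2 // posrE; nra.
apply: (@le_trans _ _ (7 * (K%:R / 3)^-1)); first by move: h3 h4; lra.
rewrite invf_div mulrA ler_pdivrMr; last by rewrite ltr0n.
by move: hKeps; lra.
Qed.
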